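(* Let $q$ be a prime power, let $A$ be a residually finite dimensional algebra over the finite field $k=\mathbb{F}_q$ (not necessarily associative), and let $Q$ be a homogeneous polynomial in $n$ variables (an element of the free algebra on $x_1,\dots,x_n$ over $k$ in the category of algebras to which $A$ belongs). Then the following are equivalent: (1) The polynomial $Q$ is a probabilistic identity of $A$. (2) The polynomial $Q$ is a coset identity of some finite index ideal $I$ of $A$; that is, there exist a finite index ideal $I$ of $A$ and $a_1,\dots,a_n\in A$ such that $Q$ vanishes identically on $(a_1+I)\times\cdots\times(a_n+I)$. Furthermore, if $Q$ is multilinear, then these conditions are equivalent to: (3) $Q$ is an identity of some finite index ideal $I$ of $A$; that is, there exists a finite index ideal $I$ of $A$ such that $Q(y_1,\dots,y_n)=0$ for all $y_1,\dots,y_n\in I$.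
   Context: An algebra over $k$ is a $k$-vector space $A$, possibly of infinite dimension, with a $k$-bilinear multiplication $A\times A\to A$; no associativity, commutativity or unit is assumed. One may work in the category of all algebras, or of associative (possibly non-unital), Lie, or Jordan algebras; a polynomial $Q$ in $n$ variables is an element of the free (non-unital) algebra on $x_1,\dots,x_n$ over $k$ in the respective category, and homogeneous refers to total degree. $Q$ is multilinear if it is a linear combination of monomials in each of which every one of $x_1,\dots,x_n$ occurs exactly once. An ideal always means a two-sided ideal. $A$ is residually finite dimensional if the intersection of all ideals of $A$ of finite codimension is zero; over $\mathbb{F}_q$, finite codimension is the same as finite index. $Q$ defines an evaluation map $e_Q\colon A^n\to A$, $(a_1,\dots,a_n)\mapsto Q(a_1,\dots,a_n)$. Let $\bar A=\varprojlim A/I$, the limit being over all ideals $I$ of $A$ of finite codimension, be the completion of $A$. $A$ is a dense subalgebra of $\bar A$, and $\bar A$ is a profinite group under addition. Equip $\bar A^n$ with its normalized Haar measure. $Q$ is a probabilistic identity of $A$ if the closure in $\bar A^n$ of $e_Q^{-1}(0)\subset A^n$ has positive Haar measure. *)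

(* Defs.v *)
From HB Require Import structures.
From mathcomp Require Import all_boot all_order all_algebra.
From mathcomp Require Import generic_quotient ring_quotient sesquilinear.
From mathcomp Require Import all_classical all_reals all_analysis.

Set Implicit Arguments.
Unset Strict Implicit.
Unset Printing Implicit Defensive.

Import GRing.Theory.

Local Open Scope classical_set_scope.
Local Open Scope ring_scope.
Local Open Scope quotient_scope.

(* Algebras with an arbitrary bilinear product, possibly infinite-dimensional. *)

HB.mixin Record Lmodule_isNAAlgebra (k : nzRingType) A & GRing.Lmodule k A := {
  amul : {bilinear A -> A -> A}
}.

#[short(type="naAlgType")]
HB.structure Definition NAAlgebra (k : nzRingType) :=
  {A of GRing.Lmodule k A & Lmodule_isNAAlgebra k A}.

Declare Scope na_scope.
Delimit Scope na_scope with NA.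
Notation "x ** y" := (amul x y) (at level 40, left associativity) : na_scope.
Local Open Scope na_scope.

Variant algCat := AllAlg | AssocAlg | LieAlg | JordanAlg.

(* The Jordan case is that of linear Jordan algebras, over any k. *)
Definition in_cat (k : nzRingType) (C : algCat) (A : naAlgType k) : Prop :=
  match C with
  | AllAlg => True
  | AssocAlg => associative (fun x y : A => x ** y)
  | LieAlg =>
      (forall x : A, x ** x = 0) /\
      (forall x y z : A, x ** (y ** z) + y ** (z ** x) + z ** (x ** y) = 0)
  | JordanAlg =>
      commutative (fun x y : A => x ** y) /\
      (forall x y : A, (x ** y) ** (x ** x) = x ** (y ** (x ** x)))
  end.

(* The free algebra of a category on x_1, ..., x_n : formal expressions modulo
   the identities that hold in every algebra of the category.  The lemmas
   freeAlg_in_cat, peval_* and peval_unique below are its universal property. *)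

Inductive term (k : Type) (n : nat) : Type :=
| TVar of 'I_n
| TZero
| TAdd of term k n & term k n
| TScale of k & term k n
| TMul of term k n & term k n.
Arguments TVar {k n}.
Arguments TZero {k n}.

HB.instance Definition _ (k : Type) n := gen_eqMixin (term k n).
HB.instance Definition _ (k : Type) n := gen_choiceMixin (term k n).

Fixpoint teval (k : nzRingType) n (A : naAlgType k) (a : 'I_n -> A)
    (t : term k n) : A :=
  match t with
  | TVar i => a i
  | TZero => 0
  | TAdd s t => teval a s + teval a t
  | TScale c t => c *: teval a t
  | TMul s t => teval a s ** teval a t
  end.

Section FreeAlgebra.
Variables (k : nzRingType) (C : algCat) (n : nat).

Definition term_equiv (s t : term k n) : bool :=
  `[< forall (A : naAlgType k) (a : 'I_n -> A),
        in_cat C A -> teval a s = teval a t >].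

Lemma term_equiv_is_equiv : equiv_class_of term_equiv.
Proof.
split=> [s|s t|t s u].
- exact/asboolP.
- by apply/asboolP/asboolP => h A a hA; rewrite h.
- by move=> /asboolP h1 /asboolP h2; apply/asboolP => A a hA; rewrite h1 // h2.
Qed.

Canonical term_equiv_equiv := EquivRelPack term_equiv_is_equiv.
Canonical term_equiv_encModRel := defaultEncModRel term_equiv.

Definition freeAlg := {eq_quot term_equiv}.

HB.instance Definition _ : EqQuotient (term k n) term_equiv freeAlg :=
  EqQuotient.on freeAlg.
HB.instance Definition _ := Choice.on freeAlg.

Definition peval (Q : freeAlg) (A : naAlgType k) (a : 'I_n -> A) : A :=
  teval a (repr Q).

Lemma peval_pi (A : naAlgType k) (a : 'I_n -> A) t :
  in_cat C A -> peval (\pi_freeAlg t) a = teval a t.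
Proof.
move=> hA; rewrite /peval.
have : \pi_freeAlg (repr (\pi_freeAlg t)) == \pi_freeAlg t.
  by rewrite reprK.
by rewrite piE => /asboolP /(_ A a hA).
Qed.

Lemma freeAlg_eq (P Q : freeAlg) :
  (forall (A : naAlgType k) (a : 'I_n -> A), in_cat C A ->
     peval P a = peval Q a) -> P = Q.
Proof.
move=> h; rewrite -[P]reprK -[Q]reprK; apply/eqP; rewrite piE.
exact/asboolP.
Qed.

Definition pvar (i : 'I_n) : freeAlg := \pi_freeAlg (TVar i).
Definition pzero : freeAlg := \pi_freeAlg TZero.
Definition padd (P Q : freeAlg) : freeAlg := \pi_freeAlg (TAdd (repr P) (repr Q)).
Definition pscale (c : k) (P : freeAlg) : freeAlg := \pi_freeAlg (TScale c (repr P)).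
Definition popp (P : freeAlg) : freeAlg := pscale (-1) P.
Definition pmul (P Q : freeAlg) : freeAlg := \pi_freeAlg (TMul (repr P) (repr Q)).

Section Eval.
Variables (A : naAlgType k) (a : 'I_n -> A) (hA : in_cat C A).

Lemma pvarE i : peval (pvar i) a = a i. Proof. exact: peval_pi. Qed.
Lemma pzeroE : peval pzero a = 0. Proof. exact: peval_pi. Qed.
Lemma paddE P Q : peval (padd P Q) a = peval P a + peval Q a.
Proof. exact: peval_pi. Qed.
Lemma pscaleE c P : peval (pscale c P) a = c *: peval P a.
Proof. exact: peval_pi. Qed.
Lemma poppE P : peval (popp P) a = - peval P a.
Proof. by rewrite pscaleE scaleN1r. Qed.
Lemma pmulE P Q : peval (pmul P Q) a = peval P a ** peval Q a.
Proof. exact: peval_pi. Qed.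
End Eval.

Definition pE := (pvarE, pzeroE, poppE, paddE, pscaleE, pmulE).

Lemma paddA : associative padd.
Proof. by move=> P Q S; apply: freeAlg_eq => A a hA; rewrite !pE // addrA. Qed.
Lemma paddC : commutative padd.
Proof. by move=> P Q; apply: freeAlg_eq => A a hA; rewrite !pE // addrC. Qed.
Lemma padd0 : left_id pzero padd.
Proof. by move=> P; apply: freeAlg_eq => A a hA; rewrite !pE // add0r. Qed.
Lemma paddN : left_inverse pzero popp padd.
Proof. by move=> P; apply: freeAlg_eq => A a hA; rewrite !pE // addNr. Qed.

HB.instance Definition _ := GRing.isZmodule.Build freeAlg paddA paddC padd0 paddN.

Lemma pscaleA c d P : pscale c (pscale d P) = pscale (c * d) P.
Proof. by apply: freeAlg_eq => A a hA; rewrite !pE // scalerA. Qed.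
Lemma pscale1 : left_id 1 pscale.
Proof. by move=> P; apply: freeAlg_eq => A a hA; rewrite !pE // scale1r. Qed.
Lemma pscaleDr : right_distributive pscale +%R.
Proof. by move=> c P Q; apply: freeAlg_eq => A a hA; rewrite !pE // scalerDr. Qed.
Lemma pscaleDl P : {morph pscale^~ P : c d / c + d}.
Proof. by move=> c d; apply: freeAlg_eq => A a hA; rewrite !pE // scalerDl. Qed.

HB.instance Definition _ := GRing.Zmodule_isLmodule.Build k freeAlg
  pscaleA pscale1 pscaleDr pscaleDl.

Lemma pmul_bilinear : bilinear_for *:%R *:%R pmul.
Proof.
split=> [Q c P S|P c Q S]; apply: freeAlg_eq => A a hA; rewrite !pE //.
  exact: linearPl.
exact: linearPr.
Qed.

HB.instance Definition _ := bilinear_isBilinear.Build k freeAlg freeAlg freeAlg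
  _ _ pmul pmul_bilinear.

HB.instance Definition _ := Lmodule_isNAAlgebra.Build k freeAlg pmul.

Lemma freeAlg_in_cat : in_cat C freeAlg.
Proof.
suff H : forall D, D = C -> in_cat D freeAlg by exact: H.
case=> //= eC.
- move=> P Q S; apply: freeAlg_eq => A a hA; rewrite !pE //.
  by move: hA; rewrite -eC; apply.
- split=> [P|P Q S]; apply: freeAlg_eq => A a hA; rewrite !pE //;
    by move: hA; rewrite -eC => -[].
- split=> [P Q|P Q]; apply: freeAlg_eq => A a hA; rewrite !pE //;
    by move: hA; rewrite -eC => -[].
Qed.

Lemma peval_unique (A : naAlgType k) (a : 'I_n -> A)
    (f : {linear freeAlg -> A}) :
  in_cat C A -> {morph f : P Q / P ** Q} -> (forall i, f (pvar i) = a i) ->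
  forall Q, f Q = peval Q a.
Proof.
move=> hA fM fX Q; rewrite -[Q]reprK peval_pi //.
elim: (repr Q) => [i||s IHs t IHt|c t IH|s IHs t IHt] /=.
- exact: fX.
- exact: linear0.
- rewrite -IHs -IHt -linearD; congr (f _); apply: freeAlg_eq => B b hB.
  by rewrite !(pE, peval_pi).
- rewrite -IH -linearZ; congr (f _); apply: freeAlg_eq => B b hB.
  by rewrite !(pE, peval_pi).
- rewrite -IHs -IHt -fM; congr (f _); apply: freeAlg_eq => B b hB.
  by rewrite !(pE, peval_pi).
Qed.

End FreeAlgebra.

(* Non-associative monomials in x_1, ..., x_n : bracketed words. *)
Inductive monom (n : nat) : Type :=
| MVar of 'I_n
| MMul of monom n & monom n.

Fixpoint letters n (m : monom n) : seq 'I_n :=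
  match m with
  | MVar i => [:: i]
  | MMul m1 m2 => letters m1 ++ letters m2
  end.

Section Polynomials.
Variables (k : nzRingType) (C : algCat) (n : nat).
Implicit Type Q : freeAlg k C n.

Fixpoint pmonom (m : monom n) : freeAlg k C n :=
  match m with
  | MVar i => pvar k C i
  | MMul m1 m2 => pmonom m1 ** pmonom m2
  end.

Definition lin_comb_of (P : pred (monom n)) Q : Prop :=
  exists2 s : seq (k * monom n),
    all (fun t => P t.2) s & Q = \sum_(t <- s) t.1 *: pmonom t.2.

Definition homogeneous Q : Prop :=
  exists d : nat, lin_comb_of (fun m => size (letters m) == d) Q.

Definition multilinear Q : Prop :=
  lin_comb_of (fun m => [forall i : 'I_n, count_mem i (letters m) == 1%N]) Q.

End Polynomials.

Section Ideals.
Variables (k : nzRingType) (A : naAlgType k).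

Definition is_ideal (I : set A) : Prop :=
  [/\ I 0,
      forall x y, I x -> I y -> I (x + y),
      forall c x, I x -> I (c *: x)
    & forall a x, I x -> I (a ** x) /\ I (x ** a)].

(* A / I is spanned by the classes of finitely many vectors. *)
Definition finite_codim (I : set A) : Prop :=
  exists (m : nat) (b : 'I_m -> A),
    forall a, exists c : 'I_m -> k, I (a - \sum_(i < m) c i *: b i).

Definition finite_index (I : set A) : Prop :=
  finite_set (range (fun a : A => [set a + y | y in I])).

Definition residually_finite_dim : Prop :=
  \bigcap_(I in [set I : set A | is_ideal I /\ finite_codim I]) I = [set 0].

Record fcIdeal := FCIdeal {
  fcset :> set A;
  fcset_ideal : is_ideal fcset;
  fcset_codim : finite_codim fcset
}.

HB.instance Definition _ := gen_eqMixin fcIdeal.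
HB.instance Definition _ := gen_choiceMixin fcIdeal.

Definition fcpred (I : fcIdeal) : {pred A} := fun x => x \in fcset I.

Lemma fcpred_zmod_closed (I : fcIdeal) : zmod_closed (fcpred I).
Proof.
have [I0 ID IZ _] := fcset_ideal I; split=> [|x y]; first exact/mem_set.
move=> /set_mem Ix /set_mem Iy; apply/mem_set/ID => //.
by rewrite -scaleN1r; apply: IZ.
Qed.

HB.instance Definition _ (I : fcIdeal) :=
  GRing.isZmodClosed.Build A (fcpred I) (fcpred_zmod_closed I).

Definition fcquot (I : fcIdeal) : zmodType := Quotient.quot (fcpred I).

Definition fcproj (I : fcIdeal) (a : A) : fcquot I :=
  \pi_(Quotient.quot (fcpred I)) a.

(* The projective limit of the A / I, with the topology induced by the product
   of the discrete spaces A / I. *)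
Definition coherent :
    set (prod_topology (fun I : fcIdeal => discrete_topology (fcquot I))) :=
  [set x | forall I J : fcIdeal, fcset I `<=` fcset J ->
     forall a : A, x I = fcproj I a -> x J = fcproj J a].

Definition completion : Type := set_type coherent.

HB.instance Definition _ := Topological.on completion.

Definition ccoord (x : completion) (I : fcIdeal) : fcquot I := set_val x I.

Lemma completion_eq (x y : completion) :
  (forall I, ccoord x I = ccoord y I) -> x = y.
Proof. by move=> h; apply: val_inj; apply: functional_extensionality_dep. Qed.

Lemma fcproj_surj (I : fcIdeal) (u : fcquot I) : exists a, u = fcproj I a.
Proof. by exists (repr u); rewrite /fcproj reprK. Qed.

Lemma fcprojD I : {morph fcproj I : a b / a + b}.
Proof. by move=> a b; rewrite /fcproj raddfD. Qed.
Lemma fcprojN I : {morph fcproj I : a / - a}.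
Proof. by move=> a; rewrite /fcproj raddfN. Qed.

Lemma fcproj_eq I a b : fcproj I a = fcproj I b <-> fcset I (a - b).
Proof.
split=> [/eqP|h]; rewrite /fcproj.
  by rewrite -Quotient.idealrBE => /set_mem.
by apply/eqP; rewrite -Quotient.idealrBE; apply/mem_set.
Qed.

Definition mk_completion (f : forall I, fcquot I)
  (hf : coherent f) : completion := exist _ f (mem_set hf).

Lemma coherentP (x : completion) : coherent (ccoord x).
Proof. exact: set_valP. Qed.

Lemma fcproj_sub (I J : fcIdeal) a b : fcset I `<=` fcset J ->
  fcproj I a = fcproj I b -> fcproj J a = fcproj J b.
Proof. by move=> IJ /fcproj_eq h; apply/fcproj_eq/IJ. Qed.

Lemma cembed_coherent (a : A) : coherent (fun I => fcproj I a).
Proof. by move=> I J IJ b; exact: fcproj_sub. Qed.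

Definition cembed (a : A) : completion := mk_completion (@cembed_coherent a).

Lemma cadd_coherent (x y : completion) :
  coherent (fun I => ccoord x I + ccoord y I).
Proof.
move=> I J IJ a.
have [b xb] := fcproj_surj (ccoord x I); have [c yc] := fcproj_surj (ccoord y I).
rewrite xb yc (coherentP IJ xb) (coherentP IJ yc) -!fcprojD.
exact: fcproj_sub.
Qed.

Lemma copp_coherent (x : completion) : coherent (fun I => - ccoord x I).
Proof.
move=> I J IJ a; have [b xb] := fcproj_surj (ccoord x I).
rewrite xb (coherentP IJ xb) -!fcprojN; exact: fcproj_sub.
Qed.

Definition cadd x y : completion := mk_completion (@cadd_coherent x y).
Definition copp x : completion := mk_completion (@copp_coherent x).

Lemma caddA : associative cadd.
Proof. by move=> x y z; apply: completion_eq => I; apply: addrA. Qed.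
Lemma caddC : commutative cadd.
Proof. by move=> x y; apply: completion_eq => I; apply: addrC. Qed.
Lemma cadd0 : left_id (cembed 0) cadd.
Proof.
move=> x; apply: completion_eq => I; rewrite -[RHS]add0r.
by congr (_ + _); apply: raddf0.
Qed.
Lemma caddN : left_inverse (cembed 0) copp cadd.
Proof.
move=> x; apply: completion_eq => I; transitivity (0 : fcquot I).
  exact: addNr.
by symmetry; apply: raddf0.
Qed.

HB.instance Definition _ :=
  GRing.isZmodule.Build completion caddA caddC cadd0 caddN.
HB.instance Definition _ := isPointed.Build completion 0.

End Ideals.

Section Haar.
Variables (R : realType) (k : nzRingType) (A : naAlgType k) (n : nat).
Local Notation G := 'rV[completion A]_n.

Definition borelType := g_sigma_algebraType (@open G).

(* The normalized Haar measure of the compact group G: the translation-invariant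
   Radon probability measure.  G need not be metrizable, so regularity is not
   automatic. *)
Definition is_haar (mu : probability borelType R) : Prop :=
  [/\ forall (g : G) (B : set G), measurable (B : set borelType) ->
        mu [set g + x | x in B] = mu B,
      forall B : set G, measurable (B : set borelType) ->
        mu B = ereal_inf [set mu U | U in [set U : set G | open U /\ B `<=` U]]
    & forall U : set G, open U ->
        mu U = ereal_sup [set mu K | K in [set K : set G | compact K /\ K `<=` U]]].
End Haar.

Section Identities.
Variables (k : nzRingType) (C : algCat) (A : naAlgType k) (n : nat).
Variable Q : freeAlg k C n.

Definition eval_map (a : 'rV[A]_n) : A := peval Q (fun i => a 0 i).

Definition probabilistic_identity (R : realType)
    (mu : probability (borelType A n) R) : Prop :=
  (0 < mu (closure [set map_mx (@cembed k A) a | a in [set a | eval_map a = 0%R]]))%E.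

Definition coset_identity (I : set A) : Prop :=
  exists a : 'rV[A]_n, forall y : 'rV[A]_n,
    (forall i, I (y 0 i)) -> eval_map (a + y) = 0.

Definition identity_on (I : set A) : Prop :=
  forall y : 'rV[A]_n, (forall i, I (y 0 i)) -> eval_map y = 0.

End Identities.

(* Main.v *)
From HB Require Import structures.
Require Import Defs.
From mathcomp Require Import all_boot all_order all_algebra finmap.
From mathcomp Require Import generic_quotient sesquilinear.
From mathcomp Require Import all_classical all_reals all_analysis.

Set Implicit Arguments.
Unset Strict Implicit.
Unset Printing Implicit Defensive.

Import Order.TTheory GRing.Theory Num.Theory.

Local Open Scope classical_set_scope.
Local Open Scope ring_scope.
Local Open Scope na_scope.

(** The theorem holds because a polynomial map of degree at most [d] between
    abelian groups that is not identically zero is nonzero on a proportion of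
    at least [2 ^ - d] of its domain.  Indeed, if some difference
    [f (x + h) - f x] does not vanish identically, then by induction on the
    degree it is nonzero on a proportion [2 ^ - (d - 1)], and wherever it is
    nonzero, one of [f x], [f (x + h)] is nonzero, so that translation
    invariance gives the bound for [f]; otherwise [f] is a nonzero constant.
    This is [haar_nonvanishing], for the Haar measure on the kernel of the
    projection of the [n]-th power of the completion of [A] onto [(A / I)^n],
    and [haar_nonvanishing_coset] for its cosets.  It applies to the evaluation
    of [Q] modulo any ideal of finite codimension, because the product of two
    polynomial maps is polynomial ([poly_mapM]); the degree bound does not
    depend on the ideal ([eval_quot_poly_map]).

    Suppose that the closure [X] of the zeros of [Q] in [A] has positive
    measure.  Inner regularity of the complement of [X] makes [X] fill all but
    a small proportion of the union of the cosets of some open subgroup that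
    meet it, so one of these cosets is filled by [X] up to a proportion less
    than [2 ^ - d] ([haar_dense_fiber]).  Modulo each ideal of finite
    codimension, [Q] vanishes on [X], hence on that whole coset by the previous
    paragraph.  As [A] is residually finite dimensional, [Q] itself vanishes on
    the corresponding coset in [A].  The essential point is that the coset is
    chosen once, before the modulus varies.

    Conversely, a coset on which [Q] vanishes has an open closure, and open
    cosets have positive measure because finitely many translates cover the
    group.

    In the multilinear case the additivity of [Q] in one variable expresses the
    value at a point with that entry in [I] as a difference of two values at
    points with that entry in [a + I]; this turns the coset [a + I] into [I]
    one variable at a time ([multilinear_coset_identity]). *)

(** * Polynomial maps between abelian groups *)

(** Polynomiality is expressed by iterated differences, which makes sense for any
    map between abelian groups: [d] is a strict bound on the degree, so that
    [d = 0] singles out the zero map. *)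
Fixpoint poly_map (G H : zmodType) (d : nat) (f : G -> H) : Prop :=
  match d with
  | 0 => forall x, f x = 0
  | e.+1 => forall h, poly_map e (fun x => f (x + h) - f x)
  end.

Section PolyMap.
Variables G H : zmodType.
Implicit Types f g : G -> H.

Lemma poly_map_ext d f g : f =1 g -> poly_map d f -> poly_map d g.
Proof.
elim: d f g => [|d IH] f g fg /= pf => [x|h]; first by rewrite -fg.
by apply: IH (pf h) => x; rewrite !fg.
Qed.

Lemma poly_map0 d : poly_map d (fun _ : G => 0 : H).
Proof.
elim: d => [//|d IH] h /=; by apply: poly_map_ext IH => x; rewrite subr0.
Qed.

Lemma poly_mapS d f : poly_map d f -> poly_map d.+1 f.
Proof.
elim: d f => [|d IH] f pf h; last exact: IH (pf h).
by move=> x; rewrite !pf subr0.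
Qed.

Lemma poly_mapD d f g :
  poly_map d f -> poly_map d g -> poly_map d (fun x => f x + g x).
Proof.
elim: d f g => [|d IH] f g /= pf pg => [x|h]; first by rewrite pf pg addr0.
by apply: poly_map_ext (IH _ _ (pf h) (pg h)) => x; rewrite addrACA -opprD.
Qed.

Lemma poly_map_shift d f c : poly_map d f -> poly_map d (fun x => f (c + x)).
Proof.
elim: d f => [|d IH] f /= pf => [x|h]; first exact: pf.
by apply: poly_map_ext (IH _ (pf h)) => x; rewrite addrA.
Qed.

Lemma poly_map_const d (c : H) : poly_map d.+1 (fun _ : G => c).
Proof. by move=> h; apply: poly_map_ext (poly_map0 d) => x; rewrite subrr. Qed.

End PolyMap.

Lemma poly_map_le (G H : zmodType) d e (f : G -> H) :
  (d <= e)%N -> poly_map d f -> poly_map e f.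
Proof.
by move=> /subnKC <- pf; elim: (e - d)%N => [|m IH];
  [rewrite addn0 | rewrite addnS; apply: poly_mapS].
Qed.

Lemma poly_map_post (G H K : zmodType) d (u : {additive H -> K}) (f : G -> H) :
  poly_map d f -> poly_map d (u \o f).
Proof.
elim: d f => [|d IH] f /= pf => [x|h]; first by rewrite pf raddf0.
by apply: poly_map_ext (IH _ (pf h)) => x /=; rewrite raddfB.
Qed.

Lemma poly_map_pre (G H K : zmodType) d (u : {additive K -> G}) (f : G -> H) :
  poly_map d f -> poly_map d (f \o u).
Proof.
elim: d f => [|d IH] f /= pf => [x|h]; first exact: pf.
by apply: poly_map_ext (IH _ (pf (u h))) => x /=; rewrite raddfD.
Qed.

(** This lets a map on a quotient be recognised as polynomial from its lift, where
    the algebra operations are available. *)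
Lemma poly_map_descend (G H K : zmodType) d (u : {additive K -> G}) (f : G -> H) :
  (forall x, exists y, x = u y) -> poly_map d (f \o u) -> poly_map d f.
Proof.
move=> us; elim: d f => [|d IH] f /= pf => [x|h].
  by have [y ->] := us x; exact: pf.
have [y ->] := us h; apply: IH; apply: poly_map_ext (pf y) => x /=.
by rewrite raddfD.
Qed.

(** Leibniz rule for differences: [f (x + h) g (x + h) - f x g x] is the sum of
    [(f (x + h) - f x) g (x + h)] and [f x (g (x + h) - g x)], both products with
    a smaller sum of degree bounds. *)
Lemma poly_mapM (k : nzRingType) (G : zmodType) (A : naAlgType k) d e
    (f g : G -> A) :
  poly_map d f -> poly_map e g -> poly_map (d + e) (fun x => f x ** g x).
Proof.
move: {2}(d + e)%N (erefl (d + e)%N) => m.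
elim: m d e f g => [|m IH] [|d] [|e] f g // E pf pg.
- by move=> x; rewrite pf linear0l.
- by apply: poly_map_ext (poly_map0 _ _ _) => x; rewrite pf linear0l.
- by apply: poly_map_ext (poly_map0 _ _ _) => x; rewrite pg linear0r.
rewrite addSn => h.
have E1 : (d + e.+1)%N = m by case: E.
have E2 : (d.+1 + e)%N = m by rewrite addSnnS.
have p1 : poly_map m (fun x => (f (h + x) - f x) ** g (h + x)).
  rewrite -E1; apply: IH => //; last exact: poly_map_shift.
  by apply: poly_map_ext (pf h) => x; rewrite (addrC x).
have p2 : poly_map m (fun x => f x ** (g (h + x) - g x)).
  rewrite -E2; apply: IH => //.
  by apply: poly_map_ext (pg h) => x; rewrite (addrC x).
rewrite E1; apply: poly_map_ext (poly_mapD p1 p2) => x.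
by rewrite linearBl linearBr /= addrA subrK (addrC x).
Qed.

Lemma teval_poly_map (k : nzRingType) n (A : naAlgType k) (t : term k n) :
  exists d, poly_map d (fun a : 'rV[A]_n => teval (fun i => a 0 i) t).
Proof.
elim: t => [i||s [d ps] t [e pt]|c t [d pt]|s [d ps] t [e pt]] /=.
- by exists 2%N => h h' x; rewrite !mxE ![_ + h 0 i]addrC !addrK subrr.
- by exists 0%N.
- exists (maxn d e); apply: poly_mapD.
    exact: poly_map_le (leq_maxl d e) ps.
  exact: poly_map_le (leq_maxr d e) pt.
- exists d; exact: (@poly_map_post _ _ _ _ (GRing.scale c)).
- exists (d + e)%N; exact: poly_mapM.
Qed.

(** * Ideals of finite codimension over a finite field *)

Section IdealFacts.
Variables (k : nzRingType) (A : naAlgType k) (I : set A) (hI : is_ideal I).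

Lemma ideal0 : I 0. Proof. by case: hI. Qed.
Lemma idealD x y : I x -> I y -> I (x + y). Proof. by case: hI => _ + _ _; apply. Qed.
Lemma idealN x : I x -> I (- x).
Proof. by case: hI => _ _ + _; rewrite -scaleN1r; apply. Qed.
Lemma idealB x y : I x -> I y -> I (x - y).
Proof. by move=> Ix Iy; apply: idealD => //; apply: idealN. Qed.
Lemma idealZ c x : I x -> I (c *: x). Proof. by case: hI => _ _ + _; apply. Qed.
Lemma idealMl a x : I x -> I (a ** x). Proof. by case: hI => _ _ _ h /(h a)[]. Qed.
Lemma idealMr a x : I x -> I (x ** a). Proof. by case: hI => _ _ _ h /(h a)[]. Qed.

(** A polynomial induces an operation on every quotient by an ideal; working with
    congruences avoids giving the quotient an algebra structure. *)
Lemma ideal_teval n (t : term k n) (a b : 'I_n -> A) :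
  (forall i, I (a i - b i)) -> I (teval a t - teval b t).
Proof.
move=> ab; elim: t => [i||s IHs t IHt|c t IHt|s IHs t IHt] /=.
- exact: ab.
- by rewrite subrr; exact: ideal0.
- by rewrite opprD addrACA; exact: idealD.
- by rewrite -scalerBr; exact: idealZ.
- rewrite -(subrK (teval a s ** teval b t) (teval a s ** _)) -addrA.
  rewrite -linearBr -linearBl; apply: idealD; first exact: idealMl.
  exact: idealMr.
Qed.

End IdealFacts.

(** Over a finite field this is a common form of finite codimension and finite
    index that is easily seen to be stable under intersection. *)
Definition finite_reps (k : nzRingType) (A : naAlgType k) (I : set A) : Prop :=
  exists (T : finType) (r : T -> A), forall a, exists t, I (a - r t).

Section FiniteReps.
Variables (k : finFieldType) (A : naAlgType k).
Implicit Types I J : set A.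

Lemma finite_codim_reps I : finite_codim I -> finite_reps I.
Proof.
move=> [m [b hb]]; exists {ffun 'I_m -> k}, (fun c : {ffun _} => \sum_(i < m) c i *: b i).
move=> a; have [c Ic] := hb a; exists [ffun i => c i].
by under eq_bigr do rewrite ffunE.
Qed.

Lemma finite_reps_codim I : finite_reps I -> finite_codim I.
Proof.
move=> [T [r hr]]; exists #|T|, (fun i => r (enum_val i)) => a.
have [t It] := hr a; exists (fun i => (i == enum_rank t)%:R).
rewrite (bigD1 (enum_rank t)) //= eqxx scale1r big1 ?addr0 ?enum_rankK //.
by move=> i /negbTE ->; rewrite scale0r.
Qed.

Lemma finite_index_reps I : is_ideal I -> finite_index I -> finite_reps I.
Proof.
move=> hI /finite_seqP [s hs].
exists 'I_(size s), (fun i : 'I_(size s) => xget 0 (nth set0 s i)) => a.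
have : [set` s] [set a + y | y in I] by rewrite -hs; exists a.
move=> /(nthP set0) /= [i lti E]; exists (Ordinal lti); rewrite /= E.
have : [set a + y | y in I] (xget 0 [set a + y | y in I]).
  apply: (@xgetPex _ _ [set a + y | y in I]).
  by exists (a + 0), 0 => //; exact: ideal0 hI.
by move=> [y Iy <-]; rewrite opprD addNKr; exact: idealN.
Qed.

Lemma finite_reps_index I : is_ideal I -> finite_reps I -> finite_index I.
Proof.
move=> hI [T [r hr]].
apply: (@sub_finite_set _ _ (range (fun t => [set r t + y | y in I]))); last first.
  by apply: finite_image; exact: finite_finset.
move=> _ [a _ <-]; have [t It] := hr a; exists t => //.
rewrite eqEsubset; split=> _ [y Iy <-].
  exists (y - (a - r t)); first exact: idealB.
  by rewrite opprB addrC addrA subrK addrC.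
exists (a - r t + y); first exact: idealD.
by rewrite addrA addrCA subrr addr0.
Qed.

Lemma finite_repsI I J : is_ideal I -> is_ideal J ->
  finite_reps I -> finite_reps J -> finite_reps (I `&` J).
Proof.
move=> hI hJ [S [r hr]] [T [q hq]].
exists (S * T)%type, (fun u => xget 0 [set a | I (a - r u.1) /\ J (a - q u.2)]).
move=> a; have [s Is] := hr a; have [t Jt] := hq a; exists (s, t).
set b := xget _ _.
have [Ib Jb] : I (b - r s) /\ J (b - q t).
  by apply: (@xgetPex _ _ [set a | I (a - r s) /\ J (a - q t)]); exists a.
have e c : a - b = (a - c) - (b - c) by rewrite opprB addrA subrK.
by split; [rewrite (e (r s)); exact: idealB | rewrite (e (q t)); exact: idealB].
Qed.

Lemma is_idealI I J : is_ideal I -> is_ideal J -> is_ideal (I `&` J).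
Proof.
move=> hI hJ; split=> [|x y [Ix Jx] [Iy Jy]|c x [Ix Jx]|a x [Ix Jx]].
- by split; exact: ideal0.
- by split; exact: idealD.
- by split; exact: idealZ.
- by split; split; (exact: idealMl || exact: idealMr).
Qed.

Lemma fcidealI_codim (I J : fcIdeal A) : finite_codim (fcset I `&` fcset J).
Proof.
apply/finite_reps_codim/finite_repsI; try exact: fcset_ideal;
  exact/finite_codim_reps/fcset_codim.
Qed.

Definition fcidealI (I J : fcIdeal A) : fcIdeal A :=
  FCIdeal (is_idealI (fcset_ideal I) (fcset_ideal J)) (fcidealI_codim I J).

Lemma is_idealT : is_ideal [set: A]. Proof. by []. Qed.

Lemma finite_codimT : finite_codim [set: A].
Proof. by exists 0%N, (fun _ => 0) => a; exists (fun _ => 0). Qed.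

Definition fcidealT : fcIdeal A := FCIdeal is_idealT finite_codimT.

Lemma fcideal_bigI (T : choiceType) (s : seq T) (F : T -> fcIdeal A) :
  exists I : fcIdeal A, forall t, t \in s -> fcset I `<=` fcset (F t).
Proof.
elim: s => [|t s [I hI]]; first by exists fcidealT.
exists (fcidealI (F t) I) => u; rewrite inE => /predU1P[-> x []//|us x [_ Ix]].
exact: hI us _ Ix.
Qed.

End FiniteReps.

(** The ideals below a fixed [I] suffice, since [I] meets any other ideal of
    finite codimension in a third one. *)
Lemma residually_finite_dim_eq0 (k : finFieldType) (A : naAlgType k)
    (I : fcIdeal A) (x : A) :
  residually_finite_dim A ->
  (forall J : fcIdeal A, fcset J `<=` fcset I -> fcset J x) -> x = 0.
Proof.
move=> hA hx; suff : [set 0] x by [].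
rewrite -hA => J [hJ cJ].
by have [] : fcset (fcidealI I (FCIdeal hJ cJ)) x by apply: hx => y [].
Qed.

(** * Congruence cosets in the powers of the completion *)

Section Topology.
Variables (k : finFieldType) (A : naAlgType k).
Implicit Types (I J : fcIdeal A) (x y : completion A).

Lemma ccoord_le I J x y : fcset I `<=` fcset J ->
  ccoord x I = ccoord y I -> ccoord x J = ccoord y J.
Proof.
move=> IJ exy; have [a xa] := fcproj_surj (ccoord x I).
by rewrite (coherentP IJ xa) (coherentP IJ (etrans (esym exy) xa)).
Qed.

Lemma open_ccoord I (c : fcquot I) : open [set x : completion A | ccoord x I = c].
Proof.
pose K (J : fcIdeal A) := discrete_topology (fcquot J).
have -> : [set x | ccoord x I = c] =
    (set_val : completion A -> _) @^-1` (@proj _ K I @^-1` [set c]) by [].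
apply: (@open_comp _ _ (set_val : completion A -> _)) => [x _|].
  exact: initial_continuous.
apply: open_comp => [f _|]; first exact: proj_continuous.
exact: discrete_open.
Qed.

(** A neighbourhood in a projective limit is prescribed by finitely many
    coordinates, hence by a single one, because the index set is directed.
    Cofinality is expressed by a filter in order to use the universal properties
    of the product and of the initial topology. *)
Lemma nbhs_ccoord x (U : set (completion A)) : nbhs x U ->
  exists I, [set y | ccoord y I = ccoord x I] `<=` U.
Proof.
pose cl I := [set y | ccoord y I = ccoord x I].
pose F := filter_from [set: fcIdeal A] cl.
have FF : Filter F.
  apply: filter_from_filter => [|I J _ _]; first by exists (fcidealT A).
  exists (fcidealI I J) => // y /= e; split; apply: ccoord_le e => z [] //.
suff : F --> x by move=> /(_ U) h /h [I _ ?]; exists I.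
move=> {}U [_ [/= [W oW <-] Wx WU]].
pose K (J : fcIdeal A) := discrete_topology (fcquot J).
have : (set_val : completion A -> _) @ F --> (set_val x : prod_topology K).
  apply/cvg_sup => I V [_ [/= [V' oV' <-] Vx VV]].
  by exists I => // y /= e; apply: VV => /=; move: Vx; rewrite /= -/(ccoord x I) -e.
move=> /(_ W) []; first exact: open_nbhs_nbhs.
by move=> I _ IW; exists I => // y /IW Wy; apply: WU.
Qed.

Variable n : nat.
Local Notation G := 'rV[completion A]_n.

Definition rcoord I (g : G) : 'rV[fcquot I]_n := map_mx ((@ccoord k A)^~ I) g.
Definition rproj I (a : 'rV[A]_n) : 'rV[fcquot I]_n := map_mx (fcproj I) a.

Lemma rcoord_zmod_morphism I : zmod_morphism (rcoord I).
Proof. by move=> g h; apply/rowP => i; rewrite !mxE. Qed.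
HB.instance Definition _ I := GRing.isZmodMorphism.Build G 'rV[fcquot I]_n
  (rcoord I) (rcoord_zmod_morphism I).

Lemma rproj_zmod_morphism I : zmod_morphism (rproj I).
Proof. by move=> g h; apply/rowP => i; rewrite !mxE fcprojD fcprojN. Qed.
HB.instance Definition _ I := GRing.isZmodMorphism.Build 'rV[A]_n 'rV[fcquot I]_n
  (rproj I) (rproj_zmod_morphism I).

Lemma rproj_surj I (u : 'rV[fcquot I]_n) : exists a, u = rproj I a.
Proof.
have /choice [a ha] i := fcproj_surj (u 0 i).
by exists (\row_i a i); apply/rowP => i; rewrite !mxE.
Qed.

Definition rembed (a : 'rV[A]_n) : G := map_mx (@cembed k A) a.

Lemma rcoord_embed I a : rcoord I (rembed a) = rproj I a.
Proof. by apply/rowP => i; rewrite !mxE. Qed.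

Lemma rcoord_le I J (g h : G) : fcset I `<=` fcset J ->
  rcoord I g = rcoord I h -> rcoord J g = rcoord J h.
Proof.
move=> IJ /rowP e; apply/rowP => i; rewrite !mxE; apply: ccoord_le IJ _.
by have := e i; rewrite !mxE.
Qed.

Lemma finite_rproj I : finite_set [set: 'rV[fcquot I]_n].
Proof.
have [T [r hr]] := finite_codim_reps (fcset_codim I).
pose f (t : {ffun 'I_n -> T}) := rproj I (\row_i r (t i)).
apply: (@sub_finite_set _ _ (range f)).
  move=> u _; have [a ->] := rproj_surj u.
  have /choice [t ht] i := hr (a 0 i).
  exists [ffun i => t i] => //; apply/rowP => i; rewrite !mxE ffunE.
  by apply/esym/fcproj_eq.
by apply: finite_image; exact: finite_finset.
Qed.

(** The cosets of the open subgroup [ker (G -> (A / I)^n)], which is the fiber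
    of [0]; being indexed by classes, they are pairwise disjoint. *)
Definition fiber I (u : 'rV[fcquot I]_n) : set G := [set g | rcoord I g = u].

Lemma fiber_open I u : open (@fiber I u).
Proof.
rewrite openE => g gu; exists (fun i j => [set x | ccoord x I = u 0 j]).
  move=> i j; apply: open_nbhs_nbhs; split; first exact: open_ccoord.
  by rewrite /= -gu mxE (ord1 i).
by move=> h hh; apply/rowP => j; rewrite mxE; exact: hh.
Qed.

Lemma nbhs_fiber (g : G) (U : set G) :
  nbhs g U -> exists I, fiber (rcoord I g) `<=` U.
Proof.
move=> [P gP PU]; have /choice [J hJ] (j : 'I_n) := nbhs_ccoord (gP 0 j).
have [I hI] := fcideal_bigI (enum 'I_n) J; exists I => h /rowP e.
apply: PU => i j; rewrite (ord1 i); apply: hJ => /=.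
apply: ccoord_le (hI j _) _; first by rewrite mem_enum.
by have := e j; rewrite !mxE.
Qed.

Lemma open_rcoord_inv J (U : set G) :
  (forall g h, rcoord J g = rcoord J h -> U g -> U h) -> open U.
Proof.
move=> hU; rewrite openE => g Ug; apply: (@filterS _ _ _ (fiber (rcoord J g))).
  by move=> h e; apply: hU Ug.
by apply: open_nbhs_nbhs; split; first exact: fiber_open.
Qed.

End Topology.

(** * Haar measure of congruence cosets *)

(** Needed for compact sets to be closed, hence Borel: [mu] is monotone on
    measurable sets only. *)
Lemma hausdorff_completion (k : finFieldType) (A : naAlgType k) n :
  hausdorff_space 'rV[completion A]_n.
Proof.
move=> g h gh; apply/rowP => i; apply: completion_eq => I.
have nf (x : 'rV[completion A]_n) : nbhs x (fiber (rcoord I x)).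
  by apply: open_nbhs_nbhs; split; first exact: fiber_open.
have [x [xg xh]] := gh _ _ (nf g) (nf h).
by move: (etrans (esym xg) xh) => /rowP /(_ i); rewrite !mxE.
Qed.

Section HaarFacts.
Variables (R : realType) (k : finFieldType) (A : naAlgType k) (n : nat).
Variables (mu : probability (borelType A n) R) (hmu : is_haar mu).
Local Notation G := 'rV[completion A]_n.
Local Notation measurableG B := (measurable (B : set (borelType A n))).
Implicit Types (I J : fcIdeal A) (g h : G).

Lemma open_measurableG (U : set G) : open U -> measurableG U.
Proof. exact: sub_sigma_algebra. Qed.

Lemma closed_measurableG (X : set G) : closed X -> measurableG X.
Proof.
move=> cX; rewrite -(setCK X); apply: measurableC; apply: open_measurableG.
exact: closed_openC.
Qed.

Lemma haar_translate g (B : set G) :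
  measurableG B -> mu [set x | B (x - g)] = mu B.
Proof.
move=> mB; have [inv _ _] := hmu; rewrite -(inv g B mB); congr (mu _).
rewrite eqEsubset; split=> [x Bx|_ [y By <-]] /=; last by rewrite (addrC g) addrK.
by exists (x - g) => //; rewrite addrC subrK.
Qed.

Lemma fiber_translate I g :
  fiber (rcoord I g) = [set x | fiber (0 : 'rV[fcquot I]_n) (x - g)].
Proof.
rewrite eqEsubset; split => x; rewrite /fiber /= raddfB => /eqP.
  by rewrite -subr_eq0 => /eqP.
by rewrite subr_eq0 => /eqP.
Qed.

Lemma rcoord_surj I (u : 'rV[fcquot I]_n) : exists g, u = rcoord I g.
Proof. by have [a ->] := rproj_surj u; exists (rembed a); rewrite rcoord_embed. Qed.

Lemma haar_fiber I (u : 'rV[fcquot I]_n) : mu (fiber u) = mu (fiber (0 : 'rV[fcquot I]_n)).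
Proof.
have [g ->] := rcoord_surj u.
rewrite fiber_translate haar_translate //.
by apply: open_measurableG; exact: fiber_open.
Qed.

(** Finitely many fibers of equal measure cover a space of measure 1. *)
Lemma haar_fiber_gt0 I (u : 'rV[fcquot I]_n) : (0 < mu (fiber u))%E.
Proof.
rewrite lt0e measure_ge0 andbT; apply/eqP => mu0.
suff : (mu setT <= 0)%E by rewrite probability_setT lee_fin ler10.
apply: le_trans
  (content_sub_fsum mu (finite_rproj n I) (A_ := @fiber _ _ _ I) _ _ _) _ => //.
- by move=> v _; apply: open_measurableG; exact: fiber_open.
- by move=> g _; exists (rcoord I g).
rewrite fsbig1 // => v _; exact: etrans (haar_fiber v) (etrans (esym (haar_fiber u)) mu0).
Qed.

(** The zero-density bound for polynomial maps on an open subgroup.  The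
    dependence of [f] on finitely many coordinates, through [J], only serves to
    make its zero set measurable; the constant does not involve [J]. *)
Lemma haar_nonvanishing I J (H : zmodType) d (f : G -> H) :
  poly_map d f -> (forall g h, rcoord J g = rcoord J h -> f g = f h) ->
  (exists2 g, fiber (0 : 'rV[fcquot I]_n) g & f g <> 0) ->
  (mu (fiber (0 : 'rV[fcquot I]_n)) <=
     (2 ^+ d)%:E * mu (fiber (0 : 'rV[fcquot I]_n) `&` [set g | f g <> 0%R]))%E.
Proof.
set V := fiber _.
have Vo : open V by exact: fiber_open.
have VD g h : V g -> V h -> V (g + h).
  by rewrite /V /fiber /= raddfD /= => -> ->; rewrite addr0.
have VN g : V g -> V (- g) by rewrite /V /fiber /= raddfN /= => ->; rewrite oppr0.
have nzo (f' : G -> H) : (forall g h, rcoord J g = rcoord J h -> f' g = f' h) ->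
    open (V `&` [set g | f' g <> 0]).
  move=> fJ; apply: openI => //; apply: (@open_rcoord_inv _ _ _ J).
  by move=> g h /fJ /= ->.
elim: d f => [|d IH] f pf fJ [g Vg fg]; first by case: fg; exact: pf.
(* Either some difference along V is nonzero on V, or f is constant on V. *)
have [[h Vh [x Vx dfx]]|nodf] :=
    pselect (exists2 h, V h & exists2 x, V x & f (x + h) - f x <> 0).
  have dfJ y z : rcoord J y = rcoord J z -> f (y + h) - f y = f (z + h) - f z.
    by move=> e; rewrite (fJ _ _ e) (fJ (y + h) (z + h)) // !raddfD /= e.
  have := IH _ (pf h) dfJ (ex_intro2 _ _ x Vx dfx).
  set W := V `&` _; set N := V `&` _ => leW.
  have mN : measurableG N by apply: open_measurableG; exact: nzo.
  have mNh : measurableG [set x | N (x - - h)].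
    apply: open_measurableG; apply: (@open_rcoord_inv _ _ _ (fcidealI I J)).
    move=> y z e [] /=; rewrite /N /V /fiber /= !opprK !raddfD /=.
    have -> : rcoord I y = rcoord I z by apply: rcoord_le e => t [].
    by rewrite (fJ (y + h) (z + h)) // !raddfD /= (rcoord_le _ e) // => t [].
  have leN : (mu W <= mu N + mu N)%E.
    rewrite -{2}(haar_translate (- h) mN).
    apply: le_trans (measureU2 _ mN mNh); apply: le_measure.
    - by rewrite inE; apply: open_measurableG; exact: nzo.
    - by rewrite inE; exact: measurableU.
    move=> y [Vy dfy]; have [fy|fy] := pselect (f y = 0); last by left.
    (* If f y = 0 and the difference at y is nonzero, then f (y + h) <> 0. *)
    right; rewrite /= opprK; split; first exact: VD.
    by move=> /= fyh; apply: dfy; rewrite /= fyh fy subr0.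
  apply: le_trans leW _; rewrite exprSr EFinM -muleA.
  apply: lee_wpmul2l; first by rewrite lee_fin exprn_ge0.
  by rewrite mule_natl mule2n.
have -> : V `&` [set g | f g <> 0] = V.
  rewrite eqEsubset; split=> [x []//|x Vx]; split=> //= fx.
  apply: nodf; exists (g - x); first by apply: VD => //; exact: VN.
  by exists x => //; rewrite (addrC x) subrK fx subr0.
rewrite -{1}[mu V]mul1e; apply: lee_pmul => //.
by rewrite lee_fin exprn_ege1 // ler1n.
Qed.

Lemma haar_nonvanishing_coset I J (H : zmodType) d (f : G -> H) (u : 'rV[fcquot I]_n) :
  poly_map d f -> (forall g h, rcoord J g = rcoord J h -> f g = f h) ->
  (exists2 g, fiber u g & f g <> 0) ->
  (mu (fiber u) <= (2 ^+ d)%:E * mu (fiber u `&` [set g | f g <> 0%R]))%E.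
Proof.
move=> pf fJ [g <- fg].
have f'J x y : rcoord J x = rcoord J y -> f (g + x) = f (g + y).
  by move=> e; apply: fJ; rewrite !raddfD /= e.
have -> : fiber (rcoord I g) `&` [set x | f x <> 0] =
    [set x | (fiber (0 : 'rV[fcquot I]_n) `&` [set y | f (g + y) <> 0]) (x - g)].
  by rewrite fiber_translate eqEsubset; split=> x [Vx] /= fx; split=> //;
    move: fx; rewrite (addrC g) subrK.
rewrite haar_fiber haar_translate; last first.
  apply: open_measurableG; apply: openI; first exact: fiber_open.
  by apply: (@open_rcoord_inv _ _ _ J) => x y /f'J /= ->.
apply: haar_nonvanishing (poly_map_shift g pf) f'J _.
by exists 0; rewrite ?addr0 // /fiber /= raddf0.
Qed.

(** Uniformity by compactness: a compact subset of [O] is covered by finitely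
    many of the open sets measured on the right, which grow as [I] shrinks. *)
Lemma haar_open_approx (O : set G) (e : R) : open O -> 0 < e -> exists I,
  (mu O - e%:E < mu [set g | fiber (rcoord I g) `<=` O])%E.
Proof.
move=> oO e0; have [_ _ reg] := hmu.
pose inner := [set mu K | K in [set K : set G | compact K /\ K `<=` O]].
have [|_ [K [cK KO] <-]] := @ub_ereal_sup_adherent _ inner e e0.
  by rewrite -reg // fin_num_measure //; exact: open_measurableG.
rewrite -reg // => leK.
pose U I := [set g : G | fiber (rcoord I g) `<=` O].
have oU I : open (U I).
  by apply: (@open_rcoord_inv _ _ _ I) => g h e' /=; rewrite /U /= e'.
have [D _ KD] : exists2 D : {fset fcIdeal A},
    {subset D <= [set: fcIdeal A]} & K `<=` cover [set` D] U.
  move: cK; rewrite compact_cover; apply => // g /KO Og.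
  have [I hI] := nbhs_fiber (open_nbhs_nbhs (conj oO Og)).
  by exists I.
have [I hI] := fcideal_bigI (enum_fset D) id; exists I.
apply: lt_le_trans leK _; apply: le_measure; rewrite ?inE.
- by apply: closed_measurableG; apply: compact_closed cK; exact: hausdorff_completion.
- by apply: open_measurableG; exact: oU.
move=> g /KD [J DJ UJ] h e'; apply: UJ; apply: rcoord_le e'; exact: hI.
Qed.

(** A density theorem for closed sets.  Let [U] be the union of the fibers that
    miss [X], for an [I] so fine that [U] nearly exhausts the complement of [X].
    If [X] missed a proportion [2 ^ - d] of each remaining fiber, it would miss
    that proportion of the complement of [U], which contains [X]; but only a part
    of measure less than [2 ^ - d * mu X] of that complement lies outside [X]. *)
Lemma haar_dense_fiber (X : set G) (d : nat) : closed X -> (0 < mu X)%E ->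
  exists I (u : 'rV[fcquot I]_n),
    ((2 ^+ d)%:E * mu (fiber u `\` X) < mu (fiber u))%E.
Proof.
move=> cX X0; have mX := closed_measurableG cX.
have finmu (B : set G) : measurableG B -> mu B \is a fin_num.
  by move=> mB; exact: fin_num_measure.
pose c : R := 2 ^+ d; have c0 : 0 < c by exact: exprn_gt0.
(* This tolerance, multiplied by c, is exactly mu X. *)
have e0 : 0 < fine (mu X) / c.
  by rewrite divr_gt0 // fine_gt0 // X0 /= ltey_eq finmu.
have [I] := haar_open_approx (closed_openC cX) e0.
set U := [set g | _] => ltU; exists I; apply: contrapT => /forallNP nou.
have {}nou u : (mu (@fiber _ _ _ I u) <= c%:E * mu (fiber u `\` X))%E.
  by rewrite leNgt; apply/negP/nou.
have mf u : measurableG (@fiber _ _ n I u).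
  by apply: open_measurableG; exact: fiber_open.
have mU : measurableG U.
  apply: open_measurableG; apply: (@open_rcoord_inv _ _ _ I) => g h e.
  by rewrite /U /= e.
pose D := [set u | ~ (@fiber _ _ n I u `<=` ~` X)].
have UD : ~` U = \bigcup_(u in D) fiber u.
  rewrite eqEsubset; split=> [g Ug|g [u Du gu] Ug]; last by apply: Du; rewrite -gu.
  by exists (rcoord I g).
have UXD : ~` U `\` X = \bigcup_(u in D) (fiber u `\` X).
  by rewrite UD setDE setI_bigcupl.
have finD : finite_set D by apply: sub_finite_set (finite_rproj n I).
have tf : trivIset D (@fiber _ _ n I).
  by move=> u v _ _ [g [gu gv]]; exact: etrans (esym gu) gv.
have leU : (mu (~` U) <= c%:E * mu (~` U `\` X))%E.
  rewrite UXD UD !measure_fin_bigcup //=; last 2 first.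
  - by move=> u v Du Dv [g [[gu _] [gv _]]]; apply: tf => //; exists g.
  - by move=> u _; exact: measurableD.
  by rewrite ge0_mule_fsumr //; apply: lee_fsum.
have XU : X `<=` ~` U.
  by move=> g Xg Ug; exact: (Ug g erefl Xg).
have ltX : (c%:E * mu (~` U `\` X) < mu X)%E.
  have -> : ~` U `\` X = ~` X `\` U by rewrite !setDE setIC.
  rewrite measureD //; last 2 first.
  - exact: measurableC.
  - by rewrite ltey_eq finmu //; exact: measurableC.
  have -> : ~` X `&` U = U by apply/setIidr => g Ug Xg; exact: XU Xg Ug.
  rewrite -[X in (_ < X)%E]fineK ?finmu // -[X in (_ < X%:E)%E](mulfVK (lt0r_neq0 c0)).
  rewrite [(_ * c)%R]mulrC EFinM lte_pmul2l ?lte_fin //.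
  by rewrite lteBlDr ?finmu // addeC -lteBlDr.
have := le_lt_trans leU ltX; apply/negP; rewrite -leNgt.
by apply: (le_measure mu _ _ XU); rewrite inE //; exact: measurableC.
Qed.

End HaarFacts.

(** * Polynomials modulo ideals of finite codimension *)

Section Reduction.
Variables (k : finFieldType) (C : algCat) (A : naAlgType k) (n : nat).
Variable Q : freeAlg k C n.
Implicit Types I J : fcIdeal A.

Lemma fcproj_zmod_morphism J : zmod_morphism (fcproj J).
Proof. by move=> x y; rewrite fcprojD fcprojN. Qed.
HB.instance Definition _ J := GRing.isZmodMorphism.Build A (fcquot J)
  (fcproj J) (fcproj_zmod_morphism J).

Lemma fcproj_eq0 J a : fcproj J a = 0 <-> fcset J a.
Proof. by rewrite -(raddf0 (fcproj J)) fcproj_eq subr0. Qed.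

(** The class of [Q (a)] for a lift [a] of [u] to [A], which exists by
    surjectivity of [rproj J]. *)
Definition eval_quot J (u : 'rV[fcquot J]_n) : fcquot J :=
  fcproj J (eval_map Q (xget 0 [set a | u = rproj J a])).

Lemma eval_quotE J a : eval_quot (rproj J a) = fcproj J (eval_map Q a).
Proof.
rewrite /eval_quot; set b := xget _ _.
have /rowP eb : rproj J a = rproj J b.
  by apply: (@xgetPex _ _ [set b | rproj J a = rproj J b]); exists a.
apply/fcproj_eq/(ideal_teval (fcset_ideal J)) => i.
by apply/fcproj_eq; have := eb i; rewrite !mxE.
Qed.

Lemma eval_quot_poly_map :
  exists d, forall J, poly_map d (@eval_quot J).
Proof.
have [d pd] := teval_poly_map A (repr Q); exists d => J.
apply: (poly_map_descend (u := @rproj _ _ n J)); first exact: rproj_surj.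
apply: poly_map_ext (poly_map_post (fcproj J) pd) => a.
by rewrite /= eval_quotE.
Qed.

Definition zero_closure : set 'rV[completion A]_n :=
  closure [set map_mx (@cembed k A) a | a in [set a | eval_map Q a = 0]].

(** The evaluation modulo [J] is locally constant, so its vanishing passes to the
    closure. *)
Lemma zero_closure_eval_quot J g : zero_closure g -> eval_quot (rcoord J g) = 0.
Proof.
move=> Zg; have [|_ [[a /= a0 <-] e]] := Zg (fiber (rcoord J g)).
  by apply: open_nbhs_nbhs; split; first exact: fiber_open.
by rewrite -e rcoord_embed eval_quotE a0 raddf0.
Qed.

(** Density of [A] in its completion, inside a fiber: a point of the fiber is
    approximated modulo [I] and any [J] simultaneously by an element of [A],
    which then lies in the coset where [Q] vanishes. *)
Lemma fiber_zero_closure I a :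
  (forall y : 'rV[A]_n, (forall i, fcset I (y 0 i)) -> eval_map Q (a + y) = 0) ->
  fiber (rproj I a) `<=` zero_closure.
Proof.
move=> Qa g gI U /nbhs_fiber [J JU].
have [b gb] := rproj_surj (rcoord (fcidealI I J) g).
exists (rembed b); split.
  exists b => //=; rewrite -(subrK a b) addrC; apply: Qa => i.
  have : rproj I b = rproj I a.
    rewrite -gI -rcoord_embed.
    by apply: (@rcoord_le _ _ _ (fcidealI I J)) => [x []//|]; rewrite rcoord_embed.
  by move=> /rowP /(_ i); rewrite !mxE => /fcproj_eq.
apply: JU; rewrite /fiber /=; apply: (@rcoord_le _ _ _ (fcidealI I J)) => [x []//|].
by rewrite rcoord_embed.
Qed.

Variables (R : realType) (mu : probability (borelType A n) R) (hmu : is_haar mu).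

(** The fiber [u] is chosen from the degree bound alone; on it, the evaluation
    modulo each smaller [J] is zero off a set of proportion less than
    [2 ^ - d], hence zero. *)
Lemma probabilistic_identity_coset : residually_finite_dim A ->
  probabilistic_identity Q mu ->
  exists I, coset_identity Q (fcset I).
Proof.
move=> hA X0; have [d pd] := eval_quot_poly_map.
have cX : closed zero_closure by exact: closed_closure.
have [I [u ltu]] := haar_dense_fiber hmu d cX X0.
have [a ua] := rproj_surj u; exists I, a => y Iy.
apply: (residually_finite_dim_eq0 (I := I)) hA _ => J JI.
apply/fcproj_eq0; apply: contrapT => nz.
pose f (g : 'rV[completion A]_n) := eval_quot (rcoord J g).
have pf : poly_map d f by exact: (poly_map_pre (@rcoord _ _ n J) (pd J)).
have fJ g h : rcoord J g = rcoord J h -> f g = f h by rewrite /f => ->.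
have : exists2 g, fiber u g & f g <> 0.
  exists (rembed (a + y)); last by rewrite /f rcoord_embed eval_quotE.
  rewrite /fiber /= rcoord_embed ua; apply/rowP => i; rewrite !mxE.
  by apply/fcproj_eq; rewrite (addrC (a 0 i)) addrK.
move=> /(haar_nonvanishing_coset hmu pf fJ) le2.
suff : (mu (fiber u) < mu (fiber u))%E by rewrite ltxx.
apply: le_lt_trans le2 (le_lt_trans _ ltu).
apply: lee_wpmul2l; first by rewrite lee_fin exprn_ge0.
apply: le_measure; rewrite ?inE.
- apply: open_measurableG; apply: openI; first exact: fiber_open.
  by apply: (@open_rcoord_inv _ _ _ J) => g h /fJ /= ->.
- apply: measurableD; last exact: closed_measurableG.
  by apply: open_measurableG; exact: fiber_open.
by move=> g [gu fg]; split=> // Xg; apply: fg; exact: zero_closure_eval_quot.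
Qed.

Lemma coset_probabilistic_identity I :
  coset_identity Q (fcset I) -> probabilistic_identity Q mu.
Proof.
move=> [a /fiber_zero_closure aX].
apply: lt_le_trans (haar_fiber_gt0 hmu (rproj I a)) _.
apply: (le_measure mu _ _ aX); rewrite inE.
  by apply: open_measurableG; exact: fiber_open.
by apply: closed_measurableG; exact: closed_closure.
Qed.

End Reduction.

(** * Multilinear polynomials *)

Fixpoint meval (k : nzRingType) (A : naAlgType k) n (a : 'I_n -> A) (m : monom n) : A :=
  match m with
  | MVar i => a i
  | MMul m1 m2 => meval a m1 ** meval a m2
  end.

Section Multilinear.
Variables (k : nzRingType) (A : naAlgType k) (n : nat).
Implicit Types (a b c : 'I_n -> A) (m : monom n).

Lemma meval_absent i m a b :
  (forall j, j != i -> a j = b j) -> count_mem i (letters m) = 0%N ->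
  meval a m = meval b m.
Proof.
move=> ab; elim: m => [j|m1 IH1 m2 IH2] /=.
  by rewrite addn0; case: eqVneq => // ij _; exact: ab.
by rewrite count_cat => /eqP; rewrite addn_eq0 => /andP[/eqP /IH1 -> /eqP /IH2 ->].
Qed.

Lemma meval_linear i m a b c :
  (forall j, j != i -> a j = b j) -> (forall j, j != i -> a j = c j) ->
  a i = b i + c i -> count_mem i (letters m) = 1%N ->
  meval a m = meval b m + meval c m.
Proof.
move=> ab ac ai; elim: m => [j|m1 IH1 m2 IH2] /=.
  by rewrite addn0; case: eqVneq => // ->.
rewrite count_cat; case E1: (count_mem i (letters m1)) => [|[|x]];
  case E2: (count_mem i (letters m2)) => [|[|y]] // _.
  rewrite (IH2 E2) linearDr (meval_absent ab E1) -{2}(meval_absent ab E1).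
  by rewrite (meval_absent ac E1).
rewrite (IH1 E1) linearDl (meval_absent ab E2) -{2}(meval_absent ab E2).
by rewrite (meval_absent ac E2).
Qed.

Variables (C : algCat) (hC : in_cat C A).

Lemma peval_pmonom m a : peval (pmonom k C m) a = meval a m.
Proof. by elim: m => [i|m1 IH1 m2 IH2] /=; rewrite ?pvarE // pmulE // IH1 IH2. Qed.

Lemma multilinear_additive (Q : freeAlg k C n) i a b c : multilinear Q ->
  (forall j, j != i -> a j = b j) -> (forall j, j != i -> a j = c j) ->
  a i = b i + c i -> peval Q a = peval Q b + peval Q c.
Proof.
move=> [s + ->] ab ac ai; elim: s => [|[x m] s IH] /=.
  by rewrite big_nil !pzeroE // addr0.
move=> /andP[/forallP /(_ i) /eqP ct /IH e].
rewrite big_cons !paddE // e !pscaleE // !peval_pmonom (meval_linear ab ac ai ct).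
by rewrite scalerDr addrACA.
Qed.

(** Let the first [j] entries range over [I] and the others over the coset.  An
    entry [z] in [I] is the difference of [z + a] and [a], both in the coset, so
    vanishing for [j] implies vanishing for [j + 1]. *)
Lemma multilinear_coset_identity (Q : freeAlg k C n) (I : set A) :
  is_ideal I -> multilinear Q -> coset_identity Q I -> identity_on Q I.
Proof.
move=> hI mQ [a Qa].
have key j : forall z : 'rV[A]_n,
    (forall i : 'I_n, if (i < j)%N then I (z 0 i) else I (z 0 i - a 0 i)) ->
    eval_map Q z = 0.
  elim: j => [|j IH] z hz.
    by rewrite -(subrK a z) addrC; apply: Qa => i; rewrite !mxE; exact: hz.
  have [jn|nj] := ltnP j n; last first.
    by apply: IH => i; have := hz i; rewrite !(leq_trans (ltn_ord i)) // leqW.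
  pose o := Ordinal jn.
  pose upd v : 'rV[A]_n := \row_i if i == o then v else z 0 i.
  have Iupd v : I (v - a 0 o) -> eval_map Q (upd v) = 0.
    move=> Iv; apply: IH => i; rewrite mxE; case: eqVneq => [->|io].
      by rewrite /= ltnn.
    have := hz i; rewrite ltnS leq_eqVlt; case: eqP => // ij.
    by case/eqP: io; apply: val_inj.
  have Izo : I (z 0 o) by have := hz o; rewrite /= leqnn.
  have : peval Q (fun i => upd (z 0 o + a 0 o) 0 i) =
      peval Q (fun i => z 0 i) + peval Q (fun i => upd (a 0 o) 0 i).
    apply: (@multilinear_additive _ o) => // [i|i|].
    - by rewrite !mxE => /negbTE ->.
    - by rewrite !mxE => /negbTE ->.
    - by rewrite !mxE eqxx.
  rewrite -!/(eval_map _ _) [X in X = _]Iupd ?addrK // [X in _ + X]Iupd.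
    by rewrite addr0.
  by rewrite subrr; exact: ideal0.
by move=> y Iy; apply: (key n) => i; rewrite ltn_ord.
Qed.

End Multilinear.

Theorem theorem2 (R : realType) (k : finFieldType) (C : algCat)
    (A : naAlgType k) (hC : in_cat C A) (hA : residually_finite_dim A)
    (n : nat) (mu : probability (borelType A n) R) (hmu : is_haar mu)
    (Q : freeAlg k C n) (hQ : homogeneous Q) :
  (probabilistic_identity Q mu <->
   exists I : set A, is_ideal I /\ finite_index I /\ coset_identity Q I) /\
  (multilinear Q ->
   ((exists I : set A, is_ideal I /\ finite_index I /\ coset_identity Q I) <->
    (exists I : set A, is_ideal I /\ finite_index I /\ identity_on Q I))).
Proof.
split; first split.
- move=> /(probabilistic_identity_coset hmu hA) [I QI]; exists (fcset I).
  have hI := fcset_ideal I; split=> //; split=> //.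
  exact/finite_reps_index/finite_codim_reps/fcset_codim.
- move=> [I [hI [fI QI]]].
  have cI := finite_reps_codim (finite_index_reps hI fI).
  exact: (coset_probabilistic_identity hmu (I := FCIdeal hI cI)).
move=> mQ; split=> -[I [hI [fI QI]]]; exists I; do 2!split=> //.
  exact: (multilinear_coset_identity hC).
by exists 0 => y Iy; rewrite add0r; exact: QI.
Qed.
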